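(* For every nonnegative integer $d$, $$\binom{d+3}{2}\le HG(2,QA^d_1)\le \max\left(2d^2+3,\binom{d+3}{2}\right),$$ and $HG(2,QA^d_1)=\binom{d+3}{2}$ for $d=1,2,3$.
   Context: A family of sets is a set $F$ of sets. $QA^d_1$ is the class of families $F$ such that $|A\cap B|\le d$ for all distinct $A,B\in F$. A set $X$ with $|X|\le t$ is a $t$-transversal of $F$ if $X\cap A\neq\emptyset$ for every $A\in F$. $HG(t,F)$ is the least nonnegative integer $k$ such that if every subfamily $P\subseteq F$ with $|P|\le k$ has a $t$-transversal then $F$ has a $t$-transversal ($\infty$ if none exists); for a class $\mathcal C$, $HG(t,\mathcal C)=\sup_{F\in\mathcal C}HG(t,F)$. *)

(* Defs.v *)
From mathcomp Require Import all_boot all_order all_algebra.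
From mathcomp Require Import classical_sets functions cardinality.
From mathcomp Require Import reals ereal.

Set Implicit Arguments.
Unset Strict Implicit.
Unset Printing Implicit Defensive.

Import Order.TTheory GRing.Theory Num.Theory.

Local Open Scope classical_set_scope.
Local Open Scope card_scope.
Local Open Scope ring_scope.

(* Throughout, neither a family F : set (set T) nor its members need be
   finite; [A #<= `I_n] says that A has at most n elements. *)

Definition has_transversal (T : Type) (t : nat) (F : set (set T)) : Prop :=
  exists X : set T, X #<= `I_t /\ forall A, F A -> X `&` A !=set0.

Definition helly_property (T : Type) (t : nat) (F : set (set T)) (k : nat) :
    Prop :=
  (forall P : set (set T), P `<=` F -> P #<= `I_k -> has_transversal t P) ->
  has_transversal t F.

(* N together with infinity is embedded in \bar R: a nonempty set of naturals
   attains its infimum there, and ereal_inf set0 = +oo. *)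
Definition HG (R : realType) (T : Type) (t : nat) (F : set (set T)) : \bar R :=
  ereal_inf [set (k%:R)%:E | k in [set k | helly_property t F k]].

(* A class of families of sets, over arbitrary ground types. *)
Definition family_class := forall T : Type, set (set (set T)).

Definition HG_class (R : realType) (t : nat) (C : family_class) : \bar R :=
  ereal_sup [set h | exists (T : Type) (F : set (set T)),
                       C T F /\ h = HG R t F].

Definition QA1 (d : nat) : family_class := fun T F =>
  forall A B : set T, F A -> F B -> A <> B -> A `&` B #<= `I_d.

(* Main.v *)
Require Import Defs.
From mathcomp Require Import all_boot all_order all_algebra.
From mathcomp Require Import boolp.
From mathcomp Require Import classical_sets functions cardinality.
From mathcomp Require Import reals ereal.
From mathcomp Require Import fintype finset finmap zify.

(* A finite family that is minimal without a 2-transversal yields pairs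
   (A_i, X_i), where X_i is a 2-transversal of the other members, so that
   |X_i| <= 2, A_i meets X_j exactly when i <> j, and |A_i cap A_j| <= d.
   Let f(d) be the largest number of pairs in such a system. For a point x of
   degree delta (the number of X_i through x), the i with x in A_i number at
   most f(d - 1), as x can be removed from these A_i; if x is in neither A_i
   nor X_i, then A_i contains the delta other points of the X_j through x, so
   there are at most f(d - delta) such i, and at most d + 2 indices i with x
   outside A_i once delta > d. Hence f(d) <= f(d - 1) + d + 2 if some degree
   exceeds d. If all degrees are at most D, counting the pairs of A_i through
   each point gives f(d) <= 2 d D + 3. For d = 2, 3 the two counts combined
   exclude the remaining values 11 and 16. The lower bound comes from all
   (d + 1)-subsets of d + 3 points. *)

Set Implicit Arguments.
Unset Strict Implicit.
Unset Printing Implicit Defensive.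

Import Order.TTheory GRing.Theory Num.Theory.

(** * Cross systems and their elementary reductions *)

Definition cross_system (I V : finType) (k : nat) (A X : I -> {set V})
    (J : {set I}) : Prop :=
  [/\ {in J, forall i, #|X i| <= 2},
      {in J, forall i, A i :&: X i = set0},
      {in J &, forall i j, i != j -> A i :&: X j != set0} &
      {in J &, forall i j, i != j -> #|A i :&: A j| < k}].

Definition cross_bound (k n : nat) : Prop :=
  forall (I V : finType) (A X : I -> {set V}) (J : {set I}),
    cross_system k A X J -> #|J| <= n.

Lemma cross_systemS (I V : finType) k (A X : I -> {set V}) (J K : {set I}) :
  K \subset J -> cross_system k A X J -> cross_system k A X K.
Proof.
move=> /subsetP sKJ [X2 AX0 AXn Ak]; split.
- by move=> i /sKJ; apply: X2.
- by move=> i /sKJ; apply: AX0.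
- by move=> i j /sKJ iJ /sKJ; apply: AXn.
- by move=> i j /sKJ iJ /sKJ; apply: Ak.
Qed.

(* [N] misses every [X j], being contained in [A j], so removing it from the
   [A i] leaves them incident to the other [X j]. *)
Lemma cross_systemD (I V : finType) k (A X : I -> {set V}) (J : {set I})
    (N : {set V}) :
  {in J, forall i, N \subset A i} -> cross_system k A X J ->
  cross_system (k - #|N|) (fun i => A i :\: N) X J.
Proof.
move=> NA [X2 AX0 AXn Ak]; split=> //.
- by move=> i iJ; rewrite setIDAC AX0 // set0D.
- move=> i j iJ jJ ij; have /set0Pn[y] := AXn i j iJ jJ ij.
  rewrite inE => /andP[yA yX]; apply/set0Pn; exists y; rewrite !inE yA yX !andbT.
  apply/negP => /(subsetP (NA j jJ)) yAj.
  by have := in_set0 y; rewrite -(AX0 j jJ) inE yAj yX.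
- move=> i j iJ jJ ij; have Aij := Ak i j iJ jJ ij.
  have sN : N \subset A i :&: A j by rewrite subsetI !NA.
  rewrite -setDIl cardsD (setIidPr sN) ltn_sub2r //.
  exact: leq_ltn_trans (subset_leq_card sN) Aij.
Qed.


(** Since [k] stands for d + 1, the value 0 forbids any two indices; the recursion on [k] starts
    here, one step below d = 0. *)
Lemma cross_bound0 : cross_bound 0 1.
Proof.
move=> I V A X J [_ _ _ Ak]; rewrite leqNgt; apply/negP => /card_gt1P.
by move=> [i [j [iJ jJ ij]]]; have := Ak i j iJ jJ ij.
Qed.

(** Any n + 1 indices of a larger system form a system, so only one exact size has to be excluded
    and later counts become numerical. *)
Lemma cross_bound_exact (k n : nat) :
  (forall (I V : finType) (A X : I -> {set V}) (J : {set I}),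
    cross_system k A X J -> #|J| <> n.+1) -> cross_bound k n.
Proof.
move=> H I V A X J cJ; rewrite leqNgt; apply/negP => ltnJ.
pose K := [set i in take n.+1 (enum J)].
have KJ : K \subset J.
  by apply/subsetP => i; rewrite inE => /mem_take; rewrite mem_enum.
apply: (H _ _ _ _ _ (cross_systemS KJ cJ)).
rewrite cardsE (card_uniqP _) ?take_uniq ?enum_uniq //.
by rewrite size_takel // -cardE.
Qed.

(** Convexity: with s = a + b, over the integers the right side exceeds s (s - 2) by (a - b)^2, and
    s >= m - 1. *)
Lemma mul_pred_sum (m a b : nat) : m <= (a + b).+1 ->
  (m - 1) * (m - 3) <= 2 * (a * a.-1 + b * b.-1).
Proof.
move=> mab; apply: (@leq_trans ((a + b) * (a + b - 2))).
  by apply: leq_mul; lia.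
have sq c : c * c.-1 + c = c * c by case: c => //= c; rewrite mulnSr.
have [ab2|ab2] := leqP (a + b) 1; first by rewrite (_ : a + b - 2 = 0); lia.
have sum_sq : (a + b) * (a + b - 2) + 2 * (a + b) = a * a + b * b + 2 * (a * b).
  by rewrite mulnC -mulnDl subnK // mulnDl !mulnDr (mulnC b a); lia.
have [+ _] := nat_Cauchy a b; rewrite -!mulnn; move: sum_sq (sq a) (sq b).
by move: (_ * (_ - 2)) (a * a.-1) (b * b.-1) (a * a) (b * b) (a * b) => *; lia.
Qed.

(** * Degrees and double counting in a fixed system *)

Section CrossSystem.
Variables (I V : finType) (k : nat) (A X : I -> {set V}) (J : {set I}).
Hypothesis cJ : cross_system k A X J.

Definition star (x : V) := [set i in J | x \in X i].
Definition hit (x : V) := [set i in J | x \in A i].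
Definition off (x : V) := J :\: (star x :|: hit x).
(** The second point of [X f] when [x] is one of them; the default [x] arises only if [X f] has no
    other point, which [starP] excludes. *)
Definition nb (x : V) (f : I) := odflt x [pick y in X f :\ x].

Lemma card_star_hit_off x : #|J| = #|star x| + #|hit x| + #|off x|.
Proof.
case: cJ => _ AX0 _ _.
have dis : star x :&: hit x = set0.
  apply/setP => i; rewrite !inE; apply/negP => /andP[/andP[iJ xX] /andP[_ xA]].
  by have := in_set0 x; rewrite -(AX0 i iJ) inE xA xX.
have sJ : star x :|: hit x \subset J.
  by apply/subsetP => i; rewrite !inE -andb_orr => /andP[].
rewrite -(cardsID (star x :|: hit x) J) (setIidPr sJ) cardsU dis cards0 subn0.
by [].
Qed.

Lemma starP x f i : f \in star x -> i \in J -> x \notin A i -> i != f ->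
  X f = [set x; nb x f] /\ nb x f \in A i.
Proof.
case: cJ => X2 AX0 AXn _; rewrite inE => /andP[fJ xX] iJ xA ne.
have /set0Pn[y] := AXn i f iJ fJ ne; rewrite inE => /andP[yA yX].
have yx : y != x by apply: contraNneq xA => <-.
have Xf : X f = [set x; y].
  apply/esym/eqP; rewrite eqEcard cards2 eq_sym yx X2 // andbT.
  by apply/subsetP => z; rewrite !inE => /orP[] /eqP->.
suff -> : nb x f = y by [].
rewrite /nb; case: pickP => [z|/(_ y)] /=; last by rewrite !inE yx yX.
by rewrite Xf !inE; case: eqP => //= _ /eqP.
Qed.

(** As [A i] avoids [x], it meets each such [X f] in the other point. These points are distinct:
    equal ones would give [X f = X g], but [A f] meets [X g] and misses [X f]. *)
Lemma star_nb x (S : {set I}) i : S \subset star x -> i \in J -> x \notin A i ->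
  i \notin S -> nb x @: S \subset A i /\ #|nb x @: S| = #|S|.
Proof.
move=> /subsetP sS iJ xA iS.
have P f : f \in S -> X f = [set x; nb x f] /\ nb x f \in A i.
  by move=> fS; apply: starP (sS f fS) iJ xA _; apply: contraNneq iS => ->.
split; first by apply/subsetP => _ /imsetP[f fS ->]; have [] := P f fS.
apply: card_in_imset => f g fS gS eq_nb; apply/eqP/negPn/negP => ne.
case: cJ => _ AX0 AXn _.
have /[!inE]/andP[fJ _] := sS f fS; have /[!inE]/andP[gJ _] := sS g gS.
have := AXn f g fJ gJ ne.
by rewrite (P g gS).1 -eq_nb -(P f fS).1 AX0 // eqxx.
Qed.

Lemma hit_le x n : cross_bound k.-1 n -> #|hit x| <= n.
Proof.
move=> bnd.
have sJ : hit x \subset J by apply/subsetP => i /[!inE]/andP[].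
have := cross_systemD (N := [set x]) _ (cross_systemS sJ cJ).
rewrite cards1 subn1 => H; apply: bnd (H _).
by move=> i; rewrite inE sub1set => /andP[].
Qed.

Lemma off_le x n : cross_bound (k - #|star x|) n -> #|off x| <= n.
Proof.
move=> bnd; have [->|[i0 i0M]] := set_0Vmem (off x); first by rewrite cards0.
have P i : i \in off x -> nb x @: star x \subset A i /\ #|nb x @: star x| = #|star x|.
  rewrite !inE => /andP[/norP[xX xA] iJ]; rewrite iJ in xX xA.
  by apply: star_nb => //; rewrite inE iJ.
have sJ : off x \subset J by apply/subsetP => i /[!inE]/andP[].
have := cross_systemD (N := nb x @: star x) _ (cross_systemS sJ cJ).
rewrite (P i0 i0M).2 => H; apply: bnd (H _).
by move=> i /P[].
Qed.

(** The second points of the [X f] through [x] lie in both [A i] and [A j]; the indices i and j are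
    left out because [A i] misses [X i]. *)
Lemma star_pair x i j : i \in J -> j \in J -> i != j ->
  x \notin A i -> x \notin A j -> #|star x :\: [set i; j]| < k.
Proof.
move=> iJ jJ ij xi xj; set S := _ :\: _.
have sS : S \subset star x by apply: subsetDl.
have [Ni <-] : nb x @: S \subset A i /\ #|nb x @: S| = #|S|.
  by apply: star_nb => //; rewrite !inE eqxx.
have [Nj _] : nb x @: S \subset A j /\ #|nb x @: S| = #|S|.
  by apply: star_nb => //; rewrite !inE eqxx orbT.
have sN : nb x @: S \subset A i :&: A j by rewrite subsetI Ni.
by apply: (leq_ltn_trans (subset_leq_card sN)); case: cJ => _ _ _; apply.
Qed.

(** Apply [star_pair] to indices of star or off. Two off indices would give |star| < k; one off and
    one star index give |star| <= k; two star indices give |star| <= k + 1. *)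
Lemma star_off_le x : k <= #|star x| -> #|star x| + #|off x| <= k.+1.
Proof.
move=> kS.
have starJ i : i \in star x -> i \in J /\ x \notin A i.
  rewrite inE => /andP[iJ xX]; split=> //; apply/negP => xA.
  case: cJ => _ AX0 _ _.
  by have := in_set0 x; rewrite -(AX0 i iJ) inE xA xX.
have offJ i : i \in off x -> [/\ i \in J, x \notin A i & i \notin star x].
  by rewrite !inE => /andP[/norP[+ +] iJ]; rewrite iJ /= => -> ->.
have pairS i j : i \in star x :|: off x -> j \in star x :|: off x -> i != j ->
    #|star x :\: [set i; j]| < k.
  have J_ l : l \in star x :|: off x -> l \in J /\ x \notin A l.
    by rewrite in_setU => /orP[/starJ//|/offJ[]].
  by move=> /J_[iJ xi] /J_[jJ xj] ij; apply: star_pair.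
have [M1|/card_gt1P[i [j [iM jM ij]]]] := leqP #|off x| 1; last first.
  have [_ _ iS] := offJ i iM; have [_ _ jS] := offJ j jM.
  have := pairS i j; rewrite !in_setU iM jM !orbT => /(_ isT isT ij).
  suff -> : star x :\: [set i; j] = star x by rewrite ltnNge kS.
  apply/setP => l; rewrite in_setD in_set2.
  by case: eqP => [->|_]; [rewrite (negPf iS)|case: eqP => [->|//]; rewrite (negPf jS)].
have [M0|[i iM]] := set_0Vmem (off x).
  rewrite M0 cards0 addn0; have [|/card_gt1P[i [j [iS jS ij]]]] := leqP #|star x| 1.
    by move=> /leq_trans; apply.
  have := pairS i j; rewrite !in_setU iS jS => /(_ isT isT ij).
  rewrite cardsD; have := subset_leq_card (subsetIr (star x) [set i; j]).
  by rewrite cards2 ij; lia.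
have [S0|[j jS]] := set_0Vmem (star x).
  by rewrite S0 cards0; lia.
have [_ _ iS] := offJ i iM.
have ij : i != j by apply: contraNneq iS => ->.
have := pairS i j; rewrite !in_setU iM jS orbT => /(_ isT isT ij).
rewrite cardsD; have : star x :&: [set i; j] \subset [set j].
  apply/subsetP => l; rewrite !inE; case: (l =P i) => /= [li|_ /andP[]//].
  by move: iS; rewrite -li inE => /negPf->.
by move=> /subset_leq_card; rewrite cards1; lia.
Qed.

Lemma card_ge_degree x n : cross_bound k.-1 n -> k <= #|star x| -> #|J| <= n + k.+1.
Proof.
move=> bnd kS; rewrite (card_star_hit_off x).
by have := hit_le x bnd; have := star_off_le kS; lia.
Qed.

(** If [X i] lies in a single point [x], every other [A j] must contain [x], so [hit x] has all
    indices but [i]. *)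
Lemma card_degenerate i n : cross_bound k.-1 n -> i \in J -> #|X i| < 2 ->
  #|J| <= n.+1.
Proof.
move=> bnd iJ Xi; case: cJ => _ _ AXn _.
have [J1|/card_gt1P[a [b [aJ bJ ab]]]] := leqP #|J| 1.
  by apply: leq_trans J1 _.
have [x Xx] : exists x, X i \subset [set x].
  have [j jJ ji] : exists2 j, j \in J & j != i.
    by case: (a =P i) => [ai|/eqP ai]; [exists b; rewrite // -ai eq_sym|exists a].
  have /set0Pn[x] := AXn j i jJ iJ ji; rewrite inE => /andP[_ xX]; exists x.
  have : [set x] == X i by rewrite eqEcard sub1set xX cards1.
  by move=> /eqP->.
have : J :\ i \subset hit x.
  apply/subsetP => j; rewrite !inE => /andP[ji jJ]; rewrite jJ /=.
  have /set0Pn[y] := AXn j i jJ iJ ji; rewrite inE => /andP[yA].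
  by move=> /(subsetP Xx); rewrite inE => /eqP <-.
move=> /subset_leq_card; have := hit_le x bnd; rewrite (cardsD1 i J) iJ; lia.
Qed.

(** Double counting of the triples (x, i, j) with i != j and x in both [A i] and [A j]. *)
Lemma sum_hit : \sum_x #|hit x| * (#|hit x|).-1 <= #|J| * (#|J|).-1 * k.-1.
Proof.
have -> : \sum_x #|hit x| * (#|hit x|).-1 =
    \sum_(i in J) \sum_(j in J | j != i) #|A i :&: A j|.
  transitivity (\sum_x \sum_(i in J) \sum_(j in J | j != i) (x \in A i :&: A j)).
    apply: eq_bigr => x _.
    rewrite -sum_nat_const big_mkcond [RHS]big_mkcond /=; apply: eq_bigr => i _.
    rewrite inE; case: (boolP (i \in J)) => //= iJ.
    case: (boolP (x \in A i)) => xi; last first.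
      by rewrite big1 // => j _; rewrite inE (negPf xi).
    rewrite (cardsD1 i (hit x)) inE iJ xi /= -sum1_card big_mkcond [RHS]big_mkcond.
    apply: eq_bigr => j _; rewrite !inE xi /=.
    by case: (j \in J); case: (j == i); case: (x \in A j).
  rewrite exchange_big; apply: eq_bigr => i _ /=.
  rewrite exchange_big; apply: eq_bigr => j _ /=.
  by rewrite -sum1_card [RHS]big_mkcond; apply: eq_bigr => x _; case: ifP.
case: cJ => _ _ _ Ak.
apply: (@leq_trans (\sum_(i in J) (#|J|).-1 * k.-1)); last by rewrite sum_nat_const mulnA.
apply: leq_sum => i iJ; apply: (@leq_trans (\sum_(j in J | j != i) k.-1)).
  apply: leq_sum => j /andP[jJ ji]; rewrite setIC.
  by have := Ak j i jJ iJ ji; lia.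
rewrite sum_nat_const leq_mul2r (cardsD1 i J) iJ /=; apply/orP; right.
by apply/eq_leq/eq_card => j; rewrite !inE andbC.
Qed.

Lemma sum_star (w : V -> nat) :
  \sum_(i in J) \sum_(x in X i) w x = \sum_x #|star x| * w x.
Proof.
rewrite (exchange_big_dep predT) //=; apply: eq_bigr => x _.
by rewrite -sum_nat_const; apply: eq_bigl => i; rewrite inE.
Qed.

Lemma pair_hit i x y : i \in J -> X i = [set x; y] -> #|J| <= (#|hit x| + #|hit y|).+1.
Proof.
move=> iJ Xi; case: cJ => _ _ AXn _.
have : J :\ i \subset hit x :|: hit y.
  apply/subsetP => j; rewrite !inE => /andP[ji jJ]; rewrite jJ /=.
  have /set0Pn[z] := AXn j i jJ iJ ji; rewrite Xi !inE => /andP[zA].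
  by move=> /orP[]/eqP <-; rewrite zA ?orbT.
move=> /subset_leq_card; rewrite cardsU (cardsD1 i J) iJ; lia.
Qed.

(* Each [x] hands out at most [p] times the number of ordered pairs of sets
   [A i], [A j] through [x], in equal shares to the [X i] containing it. *)
Lemma charge_le (p : nat) (w : V -> nat) (b : nat) : 0 < #|J| ->
  (forall x, #|star x| * w x <= p * (#|hit x| * (#|hit x|).-1)) ->
  {in J, forall i, b <= \sum_(x in X i) w x} -> b <= p * ((#|J|).-1 * k.-1).
Proof.
move=> J0 wc bw; rewrite -(leq_pmul2l J0) -sum_nat_const.
apply: (@leq_trans (\sum_(i in J) \sum_(x in X i) w x)); first exact: leq_sum.
rewrite sum_star.
apply: (@leq_trans (\sum_x p * (#|hit x| * (#|hit x|).-1))).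
  by apply: leq_sum => x _; apply: wc.
by rewrite -big_distrr /= mulnCA leq_mul2l mulnA sum_hit orbT.
Qed.

Lemma card_le_degree D : (forall x, #|star x| <= D) ->
  {in J, forall i, #|X i| = 2} -> #|J| <= 2 * k.-1 * D + 3.
Proof.
move=> degD X2; have [m3|m3] := leqP #|J| 3.
  by apply: leq_trans m3 (leq_addl _ _).
have J0 : 0 < #|J| by apply: leq_trans m3.
(* The factor 2 is that of [mul_pred_sum]: with m = |J|, the two points of [X i] carry at least (m -
   1)(m - 3), and cancelling m - 1 gives the bound. *)
pose w x := 2 * (#|hit x| * (#|hit x|).-1).
have wD x : #|star x| * w x <= 2 * D * (#|hit x| * (#|hit x|).-1).
  by rewrite /w mulnCA mulnA leq_mul // leq_mul.
have low : {in J, forall i, (#|J| - 1) * (#|J| - 3) <= \sum_(x in X i) w x}.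
  move=> i iJ; have /eqP/cards2P[x [y [xy Xi]]] := X2 i iJ.
  rewrite Xi big_setU1 /= ?big_set1 ?inE // -mulnDr mul_pred_sum //.
  exact: pair_hit iJ Xi.
have := charge_le J0 wD low.
by rewrite subn1 mulnCA leq_pmul2l; lia.
Qed.

End CrossSystem.

(** * Recursive bounds on the number of pairs *)

(** An [X i] with fewer than two points, or a point of degree at least [k], already forces at most n
    + k + 1 pairs. *)
Lemma cross_bound_rec (k n m : nat) : 0 < k -> cross_bound k.-1 n ->
  n + k.+1 <= m ->
  (forall (I V : finType) (A X : I -> {set V}) (J : {set I}),
     cross_system k A X J -> {in J, forall i, #|X i| = 2} ->
     (forall x, #|star X J x| < k) -> #|J| <> m.+1) ->
  cross_bound k m.
Proof.
move=> k0 bnd nm low; apply: cross_bound_exact => I V A X J cJ Jm.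
apply: (low I V A X J cJ _ _ Jm).
- move=> i iJ; have [] := leqP 2 #|X i|.
    by move=> X2; apply/eqP; rewrite eqn_leq X2; case: cJ => ->.
  by move=> X1; have := card_degenerate cJ bnd iJ X1; rewrite Jm; lia.
- move=> x; rewrite ltnNge; apply/negP => /(card_ge_degree cJ bnd).
  by rewrite Jm; lia.
Qed.

Lemma cross_bound_maxn (k : nat) :
  cross_bound k.+1 (maxn (2 * k ^ 2 + 3) 'C(k.+3, 2)).
Proof.
elim: k => [|k IHk].
  apply: (@cross_bound_rec 1 _ _ _ cross_bound0) => // I V A X J cJ X2 deg Jm.
  by have := card_le_degree cJ deg X2; rewrite Jm.
apply: (@cross_bound_rec k.+2 _ _ _ IHk) => //.
  (* The binomial grows by exactly k + 3 and the quadratic term by 4k + 2, which is smaller only at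
     k = 0, a numerical check. *)
  case: k {IHk} => // k; rewrite (binS k.+4 1) bin1 -!mulnn.
  by move: 'C(k.+4, 2) => c; lia.
move=> I V A X J cJ X2 deg Jm.
by have := card_le_degree cJ deg X2; rewrite Jm /= -!mulnn gtn_max; lia.
Qed.

Lemma cross_bound3 : cross_bound 3 10.
Proof.
have b2 : cross_bound 2 6 := @cross_bound_maxn 1.
have b1 : cross_bound 1 3 := @cross_bound_maxn 0.
apply: (@cross_bound_rec 3 _ _ _ b2) => // I V A X J cJ X2 deg Jm.
have J0 : 0 < #|J| by rewrite Jm.
(* Of 11 indices, at most 6 are off a point of degree 1 and at most 3 off one of degree 2, leaving
   at least 4 and 6 hits; 4 * 3 = 12 and 6 * 5 >= 2 * 12 allow the charge 12. Each [X i] then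
   receives 24, against a budget of 10 * 2 = 20. *)
have wc x : #|star X J x| * 12 <= 1 * (#|hit A J x| * (#|hit A J x|).-1).
  have := card_star_hit_off cJ x; rewrite Jm.
  have := deg x; have := hit_le cJ x b2; have := off_le cJ (x := x).
  case: #|star X J x| => [|[|[|//]]] //= off_bound c6 _.
    by have := off_bound _ b2; nia.
  by have := off_bound _ b1; nia.
have := charge_le cJ (b := 24) J0 wc; rewrite Jm => H.
suff: 24 <= 20 by []; apply: H => i iJ.
by rewrite sum_nat_const X2.
Qed.

Lemma cross_bound4 : cross_bound 4 15.
Proof.
have b3 := cross_bound3.
have b2 : cross_bound 2 6 := @cross_bound_maxn 1.
have b1 : cross_bound 1 3 := @cross_bound_maxn 0.
apply: (@cross_bound_rec 4 _ _ _ b3) => // I V A X J cJ X2 deg Jm.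
have J0 : 0 < #|J| by rewrite Jm.
pose c x := #|hit A J x|.
(* With 16 indices, degrees 1, 2, 3 force at least 5, 8, 10 hits; 28 is half of 8 * 7 and below a
   third of 10 * 9. A constant charge is capped at 5 * 4 = 20 by degree 1, and 20 + 20 is below the
   budget 15 * 3 = 45; hence the exact count there. *)
pose w x := if #|star X J x| == 1 then c x * (c x).-1 else 28.
have starc x : [\/ #|star X J x| = 0, #|star X J x| = 1 /\ 5 <= c x,
    #|star X J x| = 2 /\ 8 <= c x | #|star X J x| = 3 /\ 10 <= c x].
  have := card_star_hit_off cJ x; rewrite Jm -/(c x).
  have := deg x; have : c x <= 10 := hit_le cJ x b3.
  have := off_le cJ (x := x).
  case: #|star X J x| => [|[|[|[|//]]]] //= off_bound c10 _.
  - by move=> _; apply: Or41.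
  - by have := off_bound _ b3 => M mE; apply: Or42; split=> //; lia.
  - by have := off_bound _ b2 => M mE; apply: Or43; split=> //; lia.
  - by have := off_bound _ b1 => M mE; apply: Or44; split=> //; lia.
have wc x : #|star X J x| * w x <= 1 * (c x * (c x).-1).
  rewrite /w mul1n; case: (starc x) => [->|[-> _]|[-> c8]|[-> c10]] //=.
  - by rewrite mul1n.
  - by apply: (@leq_mul 8 7) => //; lia.
  - by apply: (@leq_trans (10 * 9)) => //; apply: leq_mul => //; lia.
have := charge_le cJ (b := 48) J0 wc; rewrite Jm => H.
suff: 48 <= 45 by []; apply: H => i iJ.
have /eqP/cards2P[x [y [xy Xi]]] := X2 i iJ.
rewrite Xi big_setU1 /= ?big_set1 ?inE //.
have starS z : z \in X i -> 0 < #|star X J z|.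
  by move=> zX; apply/card_gt0P; exists i; rewrite inE iJ.
have := pair_hit cJ iJ Xi; rewrite Jm -!/(c _).
have := starS x; have := starS y; rewrite Xi !inE !eqxx orbT => /(_ isT) sy /(_ isT) sx.
(* Two points of degree 1 have at least 15 hits together, so weight at least 7 * 6 + 8 * 7; a mixed
   pair has at least 20 + 28 = 48, any other pair 56. *)
rewrite /w; case: (starc x) sx => [->|[-> cx]|[-> cx]|[-> cx]] //= _;
case: (starc y) sy => [->|[-> cy]|[-> cy]|[-> cy]] //= _ cxy; nia.
Qed.

(** * Finite subfamilies without small transversals *)

Local Open Scope classical_set_scope.
Local Open Scope card_scope.

Definition pierced1 (T : Type) (F : set (set T)) :=
  exists p, forall A, F A -> A p.

Definition pierced2 (T : Type) (F : set (set T)) :=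
  exists p q, forall A, F A -> A p \/ A q.

Lemma infinite_notin (U : Type) (G S : set U) :
  infinite_set G -> finite_set S -> exists2 A, G A & ~ S A.
Proof.
move=> Ginf Sfin; apply: contrapT => H; apply: Ginf; apply: sub_finite_set Sfin.
by move=> A GA; apply: contrapT => SA; apply: H; exists A.
Qed.

Section Finiteness.
Variables (T : Type) (d : nat).
Implicit Types F G P : set (set T).

Lemma QA1S F G : G `<=` F -> QA1 d F -> QA1 d G.
Proof. by move=> GF QF A B /GF FA /GF; apply: QF. Qed.

Lemma QA1_finite F A B : QA1 d F -> F A -> F B -> A <> B -> finite_set (A `&` B).
Proof.
by move=> QF FA FB AB; apply: card_le_finite (QF A B FA FB AB) (finite_II d).
Qed.

(** A point piercing two given members lies in their finite intersection; adding, for each point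
    there, a member that misses it rules out all of them. *)
Lemma finite_unpierced1 G : QA1 d G -> ~ pierced1 G ->
  exists P, [/\ P `<=` G, finite_set P & ~ pierced1 P].
Proof.
move=> QG nG; have [Gfin|Ginf] := pselect (finite_set G); first by exists G; split.
have [A GA _] := infinite_notin Ginf (finite_set0 _).
have [B GB AB] := infinite_notin Ginf (finite_set1 A).
have /choice[C CP] : forall x, exists C, G C /\ ~ C x.
  move=> x; apply: contrapT => H; apply: nG; exists x => C GC.
  by apply: contrapT => Cx; apply: H; exists C.
exists ([set A; B] `|` C @` (A `&` B)); split.
- by move=> D [[]->//|[x _ <-]]; have [] := CP x.
- rewrite finite_setU; split; first exact: finite_set2.
  by apply: finite_image; apply: QA1_finite QG GA GB _ => /esym/AB.
- move=> [p Pp]; have Ap : A p by apply: Pp; left; left.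
  have Bp : B p by apply: Pp; left; right.
  by have [_] := CP p; apply; apply: Pp; right; exists p.
Qed.

(* Of three members, two share one of the two piercing points, so only the
   finitely many points in a pairwise intersection have to be excluded. *)
Lemma finite_unpierced2 F : QA1 d F -> ~ pierced2 F ->
  exists P, [/\ P `<=` F, finite_set P & ~ pierced2 P].
Proof.
move=> QF nF; have [Ffin|Finf] := pselect (finite_set F); first by exists F; split.
have [A FA _] := infinite_notin Finf (finite_set0 _).
have [B FB AB] := infinite_notin Finf (finite_set1 A).
have [C FC ABC] := infinite_notin Finf (finite_set2 A B).
(* If one [y] pierced all members missing [x], then [x] and [y] would pierce [F]; so finitely many
   members missing [x] defeat every [y]. *)
have /choice[Q QP] : forall x, exists P,
    [/\ P `<=` [set D | F D /\ ~ D x], finite_set P & ~ pierced1 P].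
  move=> x; apply: finite_unpierced1; first by apply: QA1S QF => D [].
  move=> [y Fy]; apply: nF; exists x, y => D FD.
  by have [Dx|Dx] := pselect (D x); [left|right; apply: Fy].
pose S := A `&` B `|` (A `&` C `|` B `&` C).
have Sfin : finite_set S.
  rewrite !finite_setU; split; [|split]; apply: QA1_finite QF _ _ _ => //.
  - by move=> /esym/AB.
  - by move=> AC; apply: ABC; left.
  - by move=> BC; apply: ABC; right.
pose P := [set A; B; C] `|` \bigcup_(x in S) Q x.
have SQ x y : S x -> ~ forall D, P D -> D x \/ D y.
  move=> Sx Pxy; have [QF' _ nQ] := QP x; apply: nQ; exists y => D QD.
  have [_ Dx] := QF' D QD.
  by have [//|//] : D x \/ D y by apply: Pxy; right; exists x.
exists P; split.
- move=> D [[[]->//|->//]|[x _ QD]].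
  by have [QF' _ _] := QP x; have [] := QF' D QD.
- rewrite /P !finite_setU; split; last first.
    by apply: bigcup_finite => // x _; have [] := QP x.
  by split; [split|]; apply: finite_set1.
- move=> [p [q Ppq]].
  have Pqp D : P D -> D q \/ D p by move=> /Ppq [|]; [right|left].
  have PA : P A by left; left; left.
  have PB : P B by left; left; right.
  have PC : P C by left; right.
  have Sp := SQ p q ^~ Ppq; have Sq := SQ q p ^~ Pqp.
  case: (Ppq A PA) => Ax; case: (Ppq B PB) => Bx; case: (Ppq C PC) => Cx;
  by [apply: Sp; left|apply: Sp; right; left|apply: Sp; right; right|
      apply: Sq; left|apply: Sq; right; left|apply: Sq; right; right].
Qed.

End Finiteness.

(** * Minimal finite families as cross systems *)

Lemma critical_fset (T : choiceType) (Q : {fset T} -> Prop) (D : {fset T}) : Q D ->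
  exists2 E : {fset T}, (E `<=` D)%fset & Q E /\ forall x, x \in E -> ~ Q (E `\ x)%fset.
Proof.
have [n] := ubnP #|` D|; elim: n D => // n IHn D Dn QD.
have [crit|] := pselect (forall x, x \in D -> ~ Q (D `\ x)%fset); first by exists D.
move=> /existsNP[x /not_implyP[xD /contrapT QDx]].
have [|E ED EP] := IHn _ _ QDx.
  by move: Dn; rewrite (cardfsD1 x D) xD.
by exists E => //; apply: fsubset_trans ED (fsubsetDl _ _).
Qed.


Lemma card_le_fin (T : choiceType) (V : finType) (f : V -> T) (B : {set V}) (S : set T) n :
  injective f -> (forall v, v \in B -> S (f v)) -> S #<= `I_n -> #|B| <= n.
Proof.
move=> finj BS Sn; pose X := [fset f v | v in B]%fset.
have -> : #|B| = #|` X| by rewrite card_imfset //= -cardE.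
rewrite -[X]set_fsetK; apply: geq_card_fset_set; apply: card_le_trans Sn.
by apply: subset_card_le => _ /imfsetP[v /= vB ->]; apply: BS.
Qed.

Lemma card_le_fset (T : choiceType) (X : {fset T}) n :
  ([set` X] #<= `I_n) = (#|` X| <= n).
Proof.
have /card_eq_fsetP XE : #|` X| = #|` X| by [].
by rewrite (card_le_eql XE) card_le_II.
Qed.

Lemma card_le_finset (V : finType) (B : {set V}) n :
  ([set` B] #<= `I_n) = (#|B| <= n).
Proof.
have -> : [set` B] = [set` [fset x | x in B]%fset].
  apply/seteqP; split=> x /= => [xB|/imfsetP[y /= yB ->]//].
  by apply/imfsetP; exists x.
by rewrite card_le_fset card_imfset //= -cardE.
Qed.

Lemma card_le_set2 (T : choiceType) (p q : T) : [set p; q] #<= `I_2.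
Proof.
apply: (@card_le_trans _ _ _ [set` [fset p; q]%fset]).
  by apply: subset_card_le => x [] -> /=; rewrite !inE eqxx ?orbT.
by rewrite card_le_fset cardfs2; case: (p != q).
Qed.

Lemma card_le2_sub_set2 (T : choiceType) (S : set T) (t : T) : S #<= `I_2 ->
  exists p q, S `<=` [set p; q].
Proof.
move=> S2; apply: contrapT => nS.
have out p q : exists2 r, S r & ~ [set p; q] r.
  apply: contrapT => H; apply: nS; exists p, q => r Sr.
  by apply: contrapT => nr; apply: H; exists r.
have [p Sp _] := out t t; have [q Sq pq] := out p p; have [r Sr pqr] := out p q.
have : [set` [fset p; q; r]%fset] #<= `I_2.
  apply: card_le_trans S2; apply: subset_card_le => x /=.
  by rewrite !inE => /orP[/orP[]|] /eqP->.
rewrite card_le_fset cardfsU cardfs2 cardfs1.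
have -> : ([fset p; q] `&` [fset r] = fset0)%fset.
  apply/fsetP => x; rewrite !inE; apply/negP => /andP[/orP[]/eqP -> /eqP E].
    by apply: pqr; left.
  by apply: pqr; right.
have -> : p != q by apply/eqP => E; apply: pq; left.
by rewrite cardfs0.
Qed.

Lemma pierced2_transversal (T : choiceType) (F : set (set T)) :
  pierced2 F -> has_transversal 2 F.
Proof.
move=> [p [q Fpq]]; exists [set p; q]; split; first exact: card_le_set2.
by move=> A /Fpq[]; [exists p|exists q]; split=> //; [left|right].
Qed.

Lemma transversal_pierced2 (T : choiceType) (F : set (set T)) (t : T) :
  has_transversal 2 F -> pierced2 F.
Proof.
move=> [S [/(card_le2_sub_set2 t)[p [q Spq]] SF]]; exists p, q => A /SF[x [Sx Ax]].
by have [] := Spq x Sx => xE; move: Ax; rewrite xE; [left|right].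
Qed.

Lemma cross_system_critical (T : choiceType) (d : nat) (E : {fset set T}) :
  QA1 d [set` E] -> ~ pierced2 [set` E] ->
  (forall A, A \in E -> pierced2 [set` (E `\ A)%fset]) ->
  exists (V : finType) (A X : E -> {set V}), cross_system d.+1 A X [set: E]%SET.
Proof.
move=> QE nE crit.
have /choice[p /choice[q pq]] : forall i : E, exists p, exists q,
    forall B, B \in E -> B <> fsval i -> B p \/ B q.
  move=> i; have [p [q pq]] := crit _ (fsvalP i); exists p, q => B BE Bi.
  by apply: pq => /=; rewrite !inE BE andbT; apply/eqP.
have avoid i : ~ (fsval i) (p i) /\ ~ (fsval i) (q i).
  suff H : ~ (fsval i (p i) \/ fsval i (q i)) by split=> ?; apply: H; [left|right].
  move=> pqi; apply: nE; exists (p i), (q i) => B /= BE.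
  by have [->//|Bi] := pselect (B = fsval i); apply: pq.
(* Only the piercing points are kept as ground set: incidences with the [X i] survive and
   intersections of the [A i] can only shrink. *)
pose K := ([fset p i | i : E] `|` [fset q i | i : E])%fset.
have pK i : p i \in K by rewrite inE in_imfset.
have qK i : q i \in K by rewrite inE in_imfset ?orbT.
pose p' i : K := [` pK i]%fset; pose q' i : K := [` qK i]%fset.
exists K, (fun i => [set v : K | `[< fsval i (fsval v) >]]%SET),
  (fun i => [set p' i; q' i]%SET); split.
- by move=> i _; rewrite cards2; case: (_ != _).
- move=> i _; apply/setP => v; rewrite !inE; apply/negP => /andP[/asboolP iv].
  have [np nq] := avoid i.
  by move=> /orP[]/eqP vE; move: iv; rewrite vE.
- move=> i j _ _ ij; apply/set0Pn.
  have [||ip|iq] := pq j (fsval i); first exact: fsvalP.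
  + by move=> /val_inj ijE; rewrite ijE eqxx in ij.
  + by exists (p' j); rewrite !inE eqxx andbT; apply/asboolP.
  + by exists (q' j); rewrite !inE eqxx orbT andbT; apply/asboolP.
- move=> i j _ _ ij; rewrite ltnS.
  have ne : fsval i <> fsval j.
    by move=> /val_inj ijE; rewrite ijE eqxx in ij.
  apply: (card_le_fin val_inj _ (QE _ _ (fsvalP i) (fsvalP j) ne)).
  by move=> v; rewrite !inE => /andP[/asboolP ? /asboolP ?].
Qed.

Lemma helly_QA1 (T : Type) (d n : nat) (F : set (set T)) : 0 < n ->
  cross_bound d.+1 n -> QA1 d F -> helly_property 2 F n.
Proof.
elim/Pchoice: T => T in F *.
move=> n0 bnd QF HF; apply: contrapT => nF.
(* Singleton subfamilies are within reach as [0 < n], so members are nonempty; this yields the point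
   [t] that [transversal_pierced2] takes. *)
have sub1 A : F A -> exists x, A x.
  move=> FA; have [||S [_ /(_ A erefl)[x []]]] := HF [set A]; last by exists x.
    by move=> _ ->.
  apply: (@card_le_trans _ _ _ `I_1); last by rewrite card_le_II.
  have -> : [set A] = [set` [fset A]%fset] by apply/seteqP; split=> x /=; rewrite inE => /eqP.
  by rewrite card_le_fset cardfs1.
have [A FA] : exists A, F A.
  apply: contrapT => H; apply: nF; exists classical_sets.set0; split; first exact: card_ge0.
  by move=> A FA; case: H; exists A.
have [t _] := sub1 A FA.
have nF2 : ~ pierced2 F by move=> /pierced2_transversal.
have [P [PF /finite_fsetP[D PD] nP]] := finite_unpierced2 QF nF2.
rewrite PD in PF nP.
have [E ED [nE crit]] := @critical_fset _ (fun E => ~ pierced2 [set` E]) D nP.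
have EF : [set` E] `<=` F by move=> B /= BE; apply: PF; apply: (fsubsetP ED).
have [|V [A' [X cs]]] := cross_system_critical (QA1S EF QF) nE.
  by move=> B BE; apply: contrapT; apply: crit.
have := bnd _ _ _ _ _ cs; rewrite cardsT -cardfE => En.
by apply: nE; apply: (transversal_pierced2 t); apply: HF => //; rewrite card_le_fset.
Qed.

(** * Bounds on the Helly numbers *)

Lemma HG_class_QA1_le (R : realType) (d n : nat) : 0 < n -> cross_bound d.+1 n ->
  (HG_class R 2 (QA1 d) <= (n%:R)%:E)%E.
Proof.
move=> n0 bnd; apply: ge_ereal_sup => _ [T [F [QF ->]]].
apply: ereal_inf_lbound; exists n => //=; exact: helly_QA1 QF.
Qed.

(* The family of all [d.+1]-subsets of a set of [d + 3] points: the complement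
   of a member meets exactly the other members. *)
Lemma HG_class_QA1_ge (R : realType) (d : nat) :
  (('C(d + 3, 2)%:R)%:E <= HG_class R 2 (QA1 d))%E.
Proof.
pose T : finType := 'I_(d + 3); pose G := [set B : {set T} | #|B| == d.+1]%SET.
pose F : set (set T) := [set [set` B] | B in [set` G]].
have cardG : #|G| = 'C(d + 3, 2).
  by rewrite card_draws card_ord addn3 -[RHS]bin_sub // !subSS subn0.
have memG (B : {set T}) : [set` G] B -> #|B| = d.+1.
  by rewrite /= inE => /eqP.
have QF : QA1 d F.
  move=> _ _ [B /memG BG <-] [C /memG CG <-] BC.
  have BCd : #|B :&: C| <= d.
    rewrite -ltnS -BG; apply: proper_card; rewrite properEneq subsetIl andbT.
    apply/eqP => BI; apply: BC; suff -> : B = C by [].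
    by apply/eqP; rewrite eqEcard BG CG leqnn andbT -BI subsetIr.
  apply: (@card_le_trans _ _ _ [set` (B :&: C)%SET]).
    by apply: subset_card_le => x /= [xB xC]; rewrite inE; apply/andP.
  by rewrite card_le_finset.
apply: le_trans (ereal_sup_ubound _); last by exists T, F; split; [exact: QF|reflexivity].
apply: le_ereal_inf_tmp => _ [k /= Hk <-]; rewrite lee_fin ler_nat leqNgt; apply/negP => kG.
have [P PF Pk|S [S2 SF]] := Hk.
  have [B BG PB] : exists2 B : {set T}, B \in G & ~ P [set` B].
    apply: contrapT => H; suff : #|G| <= k by rewrite cardG leqNgt kG.
    apply: (card_le_fin (f := fun B : {set T} => [set` B]) _ _ Pk).
      by move=> B C BC; apply/setP => x; apply/idP/idP => xB;
        [have : [set` C] x by rewrite -BC|have : [set` B] x by rewrite BC].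
    by move=> B BG; apply: contrapT => PB; apply: H; exists B.
  exists [set` (~: B)%SET]; split.
    by rewrite card_le_finset -(leq_add2l #|B|) cardsC card_ord (memG B BG) addSn addnS.
  move=> A PC; have [C /memG CG CE] := PF A PC; subst A.
  have [x xC xB] : exists2 x, x \in C & x \notin B.
    apply/subsetPn; apply/negP => CB; apply: PB.
    suff <- : C = B by [].
    by apply/eqP; rewrite eqEcard CB CG (memG B BG) leqnn.
  by exists x; split=> //=; rewrite inE.
pose S' := [set x : T | `[< S x >]]%SET.
have S'2 : #|S'| <= 2.
  by apply: (card_le_fin (f := id) _ _ S2) => // x; rewrite inE => /asboolP.
have : d.+1 <= #|~: S'|%SET by rewrite -(leq_add2l #|S'|) cardsC card_ord (_ : d + 3 = 2 + d.+1) ?leq_add2r //; lia.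
(* The d + 1 points of [s] avoid [S] and form a member of the family, which [S] therefore misses. *)
move=> /card_geqP[s [us sz sS]].
pose B := [set x in s]%SET.
have BG : [set` G] B.
  by rewrite /= inE cardsE (card_uniqP us) sz.
have [x [Sx xB]] := SF [set` B] (ex_intro2 _ _ B BG erefl).
move: xB; rewrite /= inE => /sS; rewrite !inE => /negP; apply.
exact/asboolP.
Qed.

Local Open Scope ring_scope.
Local Open Scope ereal_scope.

Theorem theorem2 (R : realType) (d : nat) :
  [/\ ('C(d + 3, 2)%:R)%:E <= HG_class R 2 (QA1 d),
      HG_class R 2 (QA1 d) <= ((maxn (2 * d ^ 2 + 3) 'C(d + 3, 2))%:R)%:E
    & (1 <= d <= 3)%N -> HG_class R 2 (QA1 d) = ('C(d + 3, 2)%:R)%:E].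
Proof.
have bnd := @cross_bound_maxn d; split.
- exact: HG_class_QA1_ge.
- by rewrite (addn3 d); apply: HG_class_QA1_le bnd; rewrite leq_max addn3.
- move=> d13; apply/eqP; rewrite eq_le HG_class_QA1_ge andbT.
  (* For d = 1 the general maximum is already 6; for d = 2, 3 it is 11 and 21, so the sharper bounds
     10 and 15 are needed. *)
  case: d d13 bnd => [|[|[|[|//]]]] // _ bnd; apply: HG_class_QA1_le => //.
  + exact: cross_bound3.
  + exact: cross_bound4.
Qed.
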